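(* Let $q$ be a prime power and $n\ge1$ an integer. Let $\Psi$ be an automorphism of the projective space $\mathbb{P}^n$ over $\mathbb{F}_q$, and write $\Psi=[M]\in\mathrm{PGL}_{n+1}(\mathbb{F}_q)$ for some $M\in\mathrm{GL}_{n+1}(\mathbb{F}_q)$. Then $\Psi$ acts transitively on $\mathbb{P}^n$ if and only if the characteristic polynomial $\chi_M(T)\in\mathbb{F}_q[T]$ of $M$ is projectively primitive.
   Context: $\mathbb{P}^n$ denotes the set of $\mathbb{F}_q$-points of $n$-dimensional projective space over $\mathbb{F}_q$; its automorphism group is $\mathrm{PGL}_{n+1}(\mathbb{F}_q)=\mathrm{GL}_{n+1}(\mathbb{F}_q)/\mathbb{F}_q^*\mathrm{Id}$, and $[M]$ denotes the class of $M$. A map $f:X\to X$ is transitive (acts transitively on $X$) if for any $x,y\in X$ there is an integer $i\ge0$ with $y=f^i(x)$. A polynomial $\chi(T)\in\mathbb{F}_q[T]$ of degree $m$ is projectively primitive if (i) $\chi(T)$ is irreducible over $\mathbb{F}_q$, and (ii) for any root $\alpha$ of $\chi(T)$ in $\mathbb{F}_{q^m}\cong\mathbb{F}_q[T]/(\chi(T))$, the class $\overline{\alpha}$ of $\alpha$ in the quotient group $\mathbb{F}_{q^m}^*/\mathbb{F}_q^*$ generates that group. *)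

(* Defs.v *)
From HB Require Import structures.
From mathcomp Require Import all_boot all_order all_algebra.
From mathcomp Require Import all_fingroup all_solvable all_field.

Set Implicit Arguments.
Unset Strict Implicit.
Unset Printing Implicit Defensive.

Import GroupScope GRing.Theory.
Local Open Scope ring_scope.

Definition transitive_map (X : Type) (f : X -> X) : Prop :=
  forall x y : X, exists i : nat, y = iter i f x.

Section ProjectiveSpace.
Variables (F : finFieldType) (n : nat).

(* The F-points of P^n are the lines through the origin of F^(n+1). *)
Definition proj_space : Type :=
  {U : {vspace 'cV[F]_n.+1} | \dim U == 1%N}.

Definition scalarGL : {set {'GL_n.+1[F]}} :=
  [set M | is_scalar_mx (GLval M)].

Lemma scalarGLP (M : {'GL_n.+1[F]}) :
  reflect (exists2 a : F, a != 0 & GLval M = a%:M) (M \in scalarGL).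
Proof.
rewrite inE; apply: (iffP idP) => [/is_scalar_mxP[a Ma] | [a _ Ma]]; last first.
  by apply/is_scalar_mxP; exists a.
exists a => //; apply: contraTneq (GL_unit M) => a0.
by rewrite Ma a0 raddf0 unitr0.
Qed.

Lemma scalarGL_group_set : group_set scalarGL.
Proof.
apply/group_setP; split=> [|A B].
  by apply/scalarGLP; exists 1; rewrite ?oner_neq0 ?GL_1E.
case/scalarGLP=> a a0 Aa /scalarGLP[b b0 Bb]; apply/scalarGLP.
by exists (a * b); rewrite ?mulf_neq0 // GL_MxE Aa Bb -scalar_mxM.
Qed.
Canonical scalarGL_group := Group scalarGL_group_set.

Lemma scalarGL_norm (M : {'GL_n.+1[F]}) : M \in 'N(scalarGL).
Proof.
rewrite inE; apply/subsetP=> _ /imsetP[A /scalarGLP[a a0 Aa] ->].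
have cAM : commute A M.
  have E : GLval (A * M)%g = GLval (M * A)%g by rewrite !GL_MxE Aa scalar_mxC.
  exact: val_inj E.
by rewrite /conjg cAM mulKg; apply/scalarGLP; exists a.
Qed.

(* Since the scalar matrices are normal in GL_(n+1), every element of this
   type is the coset of a matrix. *)
Definition PGL : finGroupType := coset_of scalarGL.

Definition PGL_class (M : {'GL_n.+1[F]}) : PGL := coset scalarGL M.

Lemma GL_act_dim (M : {'GL_n.+1[F]}) (P : proj_space) :
  \dim (linfun (mulmx (GLval M)) @: val P)%VS == 1%N.
Proof.
rewrite limg_dim_eq ?(valP P) //.
suff /eqP-> : lker (linfun (mulmx (GLval M) : 'cV_n.+1 -> 'cV_n.+1)) == 0%VS.
  by rewrite capv0.
by apply/lker0P=> u v; rewrite !lfunE /=; apply: (can_inj (mulKmx (GL_unit M))).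
Qed.

(* Matrices act on column vectors by left multiplication. *)
Definition GL_act (M : {'GL_n.+1[F]}) (P : proj_space) : proj_space :=
  exist _ (linfun (mulmx (GLval M)) @: val P)%VS (GL_act_dim M P).

Definition PGL_act (Psi : PGL) : proj_space -> proj_space := GL_act (repr Psi).

(* The action does not depend on the representative. *)
Lemma PGL_act_class (M : {'GL_n.+1[F]}) : PGL_act (PGL_class M) =1 GL_act M.
Proof.
move=> P; apply: val_inj => /=.
have: repr (PGL_class M) \in scalarGL :* M.
  by rewrite -val_coset ?scalarGL_norm // mem_repr_coset.
case/rcosetP=> A /scalarGLP[a a0 Aa] ->.
have -> : linfun (mulmx (GLval (A * M)%g)) =
    (a *: linfun (mulmx (GLval M)))%R :> 'Hom('cV[F]_n.+1, 'cV[F]_n.+1).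
  by apply/lfunP=> u; rewrite GL_MxE Aa mul_scalar_mx !lfunE /= lfunE /= -scalemxAl.
apply/vspaceP=> v; apply/memv_imgP/memv_imgP=> -[u Pu ->].
  by exists (a *: u); rewrite ?memvZ // scale_lfunE linearZ.
by exists (a^-1 *: u); rewrite ?memvZ // scale_lfunE linearZ scalerA mulfV // scale1r.
Qed.

End ProjectiveSpace.

Section ScalarUnits.
Variables (F L : finFieldType) (iota : {rmorphism F -> L}).

(* The image of the multiplicative group F^* in L^*. *)
Definition base_units : {set {unit L}} :=
  [set u | [exists c : F, val u == iota c]].

Lemma base_units_group_set : group_set base_units.
Proof.
apply/group_setP; split=> [|u v].
  by rewrite inE; apply/existsP; exists 1; rewrite rmorph1.
rewrite !inE => /existsP[c /eqP uc] /existsP[d /eqP vd].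
by apply/existsP; exists (c * d); rewrite rmorphM /= -uc -vd.
Qed.
Canonical base_units_group := Group base_units_group_set.

End ScalarUnits.

(* F_(q^m) is any finite field L with q^m elements given with an embedding of
   F; such an extension exists and is unique up to F-isomorphism.  The class of
   a root in L^*/F^* makes sense only if the root is a unit: in degree 1, this
   excludes chi = c *: 'X. *)
Definition projectively_primitive (F : finFieldType) (chi : {poly F}) : Prop :=
  irreducible_poly chi /\
  (forall (L : finFieldType) (iota : {rmorphism F -> L}),
     #|L| = (#|F| ^ (size chi).-1)%N ->
     forall alpha : L, root (map_poly iota chi) alpha ->
     exists2 u : {unit L}, val u = alpha &
       <[coset (base_units iota) u]>%g = ([set: {unit L}] / base_units iota)%g).

(* Main.v *)
Require Import Defs.
From mathcomp Require Import all_boot all_order all_algebra.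
From mathcomp Require Import all_fingroup all_solvable all_field.

(** Write chi for the characteristic polynomial of M and d = n + 1 for its
degree. The statement compares two modules over F[T]: the space F^d, on which
T acts as M, and the field L with #|F|^d elements, on which T acts as
multiplication by a root alpha of chi. Transitivity on projective points says
that any nonzero vector is c M^i u for a given nonzero u, and generation of
L^*/F^* by the class of alpha says that any nonzero w in L is c alpha^i.

If chi is irreducible, both modules are one-dimensional over F[T]/(chi), so
that for every nonzero u the condition h(M) u = 0 means chi | h, exactly like
h(alpha) = 0 ([horner_vec_eq0], [root_dvdp]). Since the polynomials of degree
< d are as numerous as the vectors, and as the elements of L, every vector is
some h(M) u and every element of L is some h(alpha) ([eval_onto]). Hence both
conditions say that every h prime to chi is congruent to some c T^i modulo
chi, and they are equivalent ([transitive_generatorP]).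

It remains to see that transitivity forces chi to be irreducible. If a
nonzero g of degree e kills a nonzero u, transitivity makes F^d the set of all
h(M) u, and reducing h modulo g leaves at most #|F|^e vectors, so that e >= d
([line_transitive_annihilator]). For chi = r p with p not constant, r has
degree < d, so r(M) u is nonzero; by Cayley-Hamilton it is killed by p, whose
degree is therefore d. *)

Set Implicit Arguments.
Unset Strict Implicit.
Unset Printing Implicit Defensive.

Import GRing.Theory.
Local Open Scope ring_scope.

(** * Surjectivity of polynomial evaluation by counting *)

Section PolynomialCounting.

Variables (F : finFieldType) (T : finZmodType) (m : nat).
Variables (p : {poly F}) (ev : {poly F} -> T).
Hypothesis evB : {morph ev : g h / g - h}.
Hypothesis ev_ker : forall g, ev g = 0 -> p %| g.
Hypothesis size_p : size p = m.+1.
Hypothesis cardT : #|T| = (#|F| ^ m)%N.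

(** The polynomials of degree < m are as numerous as the elements of T, and
evaluation is injective on them because a nonzero difference is too small to be
a multiple of p. Used with T = F^m and with T a field extension of degree m. *)
Lemma eval_onto (t : T) : exists h, t = ev h.
Proof.
pose evn (g : {poly_m F}) := ev (polyn g).
have inj : injective evn.
  move=> g h e; apply: val_inj => /=; apply/eqP; rewrite -subr_eq0.
  apply: contraTT isT => gh.
  have /ev_ker/(dvdp_leq gh) : ev (polyn g - polyn h) = 0.
    by rewrite evB [ev _]e subrr.
  rewrite leqNgt size_p ltnS => /negP[].
  by rewrite (leq_trans (size_polyD _ _)) // size_polyN geq_max !size_npoly.
have /codomP[g ->] : t \in codom evn.
  by apply: inj_card_onto => //; rewrite card_npoly cardT.
by exists (polyn g).
Qed.

End PolynomialCounting.

(** * Polynomials in a matrix applied to a vector *)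

Lemma exists_nonzero_cV (R : nzRingType) (n : nat) :
  exists u : 'cV[R]_n.+1, u != 0.
Proof.
exists (const_mx 1); apply/eqP=> /matrixP/(_ 0 0)/eqP.
by rewrite !mxE oner_eq0.
Qed.

Section MatrixEvaluation.

Variables (F : finFieldType) (n : nat) (A : 'M[F]_n.+1).
Implicit Types (u v : 'cV[F]_n.+1) (g h : {poly F}).

Definition horner_vec u h := horner_mx A h *m u.

Definition line_transitive :=
  forall u v, u != 0 -> v != 0 ->
  exists c : F, exists i, v = c *: (A ^+ i *m u).

Lemma horner_vecB u : {morph horner_vec u : g h / g - h}.
Proof. by move=> g h; rewrite /horner_vec rmorphB mulmxBl. Qed.

Lemma horner_vecD u : {morph horner_vec u : g h / g + h}.
Proof. by move=> g h; rewrite /horner_vec rmorphD mulmxDl. Qed.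

Lemma horner_vecM u g h : horner_vec u (g * h) = horner_vec (horner_vec u h) g.
Proof. by rewrite /horner_vec rmorphM mulmxA. Qed.

Lemma horner_vecZX u c i : horner_vec u (c *: 'X^i) = c *: (A ^+ i *m u).
Proof.
by rewrite /horner_vec linearZ /= rmorphXn /= horner_mx_X -scalemxAl.
Qed.

Lemma horner_vec_char u h : char_poly A %| h -> horner_vec u h = 0.
Proof.
by case/dvdpP=> r ->; rewrite /horner_vec rmorphM /= Cayley_Hamilton mulr0 mul0mx.
Qed.

(** An h prime to chi has an inverse modulo chi, so h(A) is invertible by
Cayley-Hamilton and kills no nonzero vector. *)
Lemma horner_vec_eq0 u h : irreducible_poly (char_poly A) -> u != 0 ->
  horner_vec u h = 0 -> char_poly A %| h.
Proof.
move=> irr u0 hu0; apply: contraNT u0 => ndvd.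
have := irreducible_poly_coprime h irr; rewrite ndvd => /Bezout_eq1_coprimepP.
case=> -[a b] /= ab1.
have -> : u = horner_vec u 1 by rewrite /horner_vec rmorph1 mul1mx.
rewrite -ab1 horner_vecD (horner_vec_char _ (dvdp_mull _ (dvdpp _))) add0r.
by rewrite horner_vecM hu0 /horner_vec mulmx0.
Qed.

(** Transitivity makes every vector a polynomial in A applied to u; if g(A)
kills u, remainders modulo g suffice, and g of degree <= n would leave too
few of them. *)
Lemma line_transitive_annihilator u g : line_transitive -> u != 0 ->
  g != 0 -> horner_vec u g = 0 -> (n.+1 < size g)%N.
Proof.
move=> tr u0 g0 gu0; rewrite ltnNge; apply/negP => sg.
pose evn (h : {poly_n F}) := horner_vec u (polyn h).
have onto v : v \in codom evn.
  have [h ->] : exists h, v = horner_vec u h.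
    case: (eqVneq v 0) => [-> | v0].
      by exists 0; rewrite /horner_vec rmorph0 mul0mx.
    by have [c [i ->]] := tr u v u0 v0; exists (c *: 'X^i); rewrite horner_vecZX.
  have sr : (size (h %% g)%R <= n)%N.
    by rewrite -ltnS (leq_trans _ sg) // ltn_modp.
  apply/codomP; exists (npolyp n (h %% g)); rewrite /evn npolypK //.
  rewrite {1}(divp_eq h g) horner_vecD horner_vecM gu0.
  by rewrite /horner_vec mulmx0 add0r.
have : (#|'cV[F]_n.+1| <= #|{: {poly_n F}}|)%N.
  apply: leq_trans (leq_image_card evn _).
  by apply: subset_leq_card; apply/subsetP=> v _; apply: onto.
by rewrite card_mx card_npoly muln1 leq_exp2l ?finNzRing_gt1 // ltnn.
Qed.

(** A factorisation chi = r p with p not constant produces the nonzero vector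
r(A) u, which p(A) kills; so p has the full degree n + 1. *)
Lemma line_transitive_irreducible : (1 <= n)%N ->
  line_transitive -> irreducible_poly (char_poly A).
Proof.
move=> n1 tr; split=> [|p sp /dvdpP[r chiE]].
  by rewrite size_char_poly.
have chi0 : char_poly A != 0 by rewrite monic_neq0 ?char_poly_monic.
have [r0 p0] : r != 0 /\ p != 0.
  by apply/andP; rewrite -negb_or -mulf_eq0 -chiE.
rewrite -dvdp_size_eqp ?chiE ?dvdp_mull // -chiE size_char_poly.
have [u u0] := exists_nonzero_cV F n.
rewrite eqn_leq; apply/andP; split.
  by rewrite -(size_char_poly A) dvdp_leq // chiE dvdp_mull.
have sr : (size r <= n.+1)%N.
  have := size_char_poly A; rewrite chiE size_mul // => e.
  have : (0 < size p)%N by rewrite size_poly_gt0.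
  move: sp e; case: (size p) => [|[|k]] // _; rewrite !addnS /= => -[<-] _.
  exact: leq_addr.
apply: (@line_transitive_annihilator (horner_vec u r)) => //.
  apply: contraTneq sr => /(line_transitive_annihilator tr u0 r0).
  by rewrite ltnNge.
by rewrite -horner_vecM mulrC -chiE horner_vec_char.
Qed.

Lemma horner_vec_onto u v : irreducible_poly (char_poly A) -> u != 0 ->
  exists h, v = horner_vec u h.
Proof.
move=> irr u0; apply: (eval_onto (p := char_poly A) (m := n.+1)).
- exact: horner_vecB.
- by move=> g; apply: horner_vec_eq0.
- by rewrite size_char_poly.
- by rewrite card_mx muln1.
Qed.

End MatrixEvaluation.

(** * Transitivity on lines in terms of vectors *)

Lemma transitive_map_ext (X : Type) (f g : X -> X) :
  f =1 g -> transitive_map f <-> transitive_map g.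
Proof.
by move=> fg; split=> tr x y; have [i ->] := tr x y; exists i;
  rewrite (eq_iter fg).
Qed.

Section LineAction.

Variables (F : finFieldType) (n : nat).
Implicit Types (M : {'GL_n.+1[F]}) (P : proj_space F n) (u : 'cV[F]_n.+1).

Lemma proj_space_line P : exists2 u, u != 0 & val P = <[u]>%VS.
Proof.
have u0 : vpick (val P) != 0 by rewrite vpick0 -dimv_eq0 (eqP (valP P)).
exists (vpick (val P)) => //; apply/eqP; rewrite eq_sym eqEdim.
by rewrite -memvE memv_pick (eqP (valP P)) dim_vline u0.
Qed.

Lemma iter_GL_act M P u i : val P = <[u]>%VS ->
  val (iter i (GL_act M) P) = <[GLval M ^+ i *m u]>%VS.
Proof.
move=> Pu; elim: i => [|i IH]; first by rewrite expr0 mul1mx.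
by rewrite iterS /= IH limg_line lfunE /= exprS mulmxA.
Qed.

Lemma GL_act_transitiveP M :
  transitive_map (GL_act M) <-> line_transitive (GLval M : 'M[F]_n.+1).
Proof.
split=> tr => [u v u0 v0 | P Q].
  have line w : w != 0 -> exists P : proj_space F n, val P = <[w]>%VS.
    move=> w0; have dw : \dim <[w]> == 1%N by rewrite dim_vline w0.
    by exists (exist _ <[w]>%VS dw).
  have [[P Pu] [Q Qv]] := (line u u0, line v v0); have [i] := tr P Q.
  move/(congr1 val); rewrite (iter_GL_act _ _ Pu) Qv => lE.
  have /vlineP[c ->] : v \in <[GLval M ^+ i *m u]>%VS by rewrite -lE memv_line.
  by exists c, i.
have [[u u0 Pu] [v v0 Qv]] := (proj_space_line P, proj_space_line Q).
have [c [i vE]] := tr u v u0 v0; exists i; apply: val_inj.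
rewrite (iter_GL_act _ _ Pu) Qv; apply/eqP; rewrite eqEdim -memvE.
rewrite {1}vE memvZ ?memv_line // !dim_vline v0.
by rewrite leq_b1.
Qed.

End LineAction.

(** * Generators of the quotient group and roots in an extension *)

Section FieldGenerators.

Variables (F L : finFieldType) (iota : {rmorphism F -> L}).
Implicit Types (p h : {poly F}) (alpha w : L).

Definition scaled_powers_onto alpha :=
  forall w, w != 0 -> exists c : F, exists i, w = iota c * alpha ^+ i.

Lemma coset_generatorP (u : {unit L}) :
  (<[coset (base_units iota) u]> = [set: {unit L}] / base_units iota)%g
  <-> scaled_powers_onto (val u).
Proof.
have nB x : x \in 'N(base_units iota)%g.
  apply: (subsetP (cents_norm _)) (in_setT x); rewrite centsC.
  apply/subsetP => y _; apply/centP => z _; apply: val_inj; exact: mulrC.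
rewrite -morphim_cycle //; split=> [gen w w0 | onto].
  have uw : w \is a GRing.unit by rewrite unitfE.
  have := mem_quotient (base_units iota) (in_setT (FinRing.Unit uw)).
  rewrite -gen => /morphimP[_ _ /cycleP[i ->] /= eqc].
  have [b] := @kercoset_rcoset _ (base_units_group iota) _ _ (nB _) (nB _) eqc.
  rewrite [_ \in _]inE => /existsP[c /eqP bc] /(congr1 val) /= wE.
  by exists c, i; rewrite wE bc FinRing.val_unitX.
apply/eqP; rewrite eqEsubset morphimS ?subsetT //=.
apply/subsetP => _ /morphimP[w _ _ ->].
have w0 : val w != 0 by rewrite -unitfE; apply: valP.
have [c [i wE]] := onto _ w0.
have bB : (w * u ^- i)%g \in base_units iota.
  rewrite inE; apply/existsP; exists c.
  rewrite FinRing.val_unitM FinRing.val_unitV FinRing.val_unitX wE.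
  by rewrite mulrK // unitrX // (valP u).
apply/morphimP; exists (u ^+ i)%g => //; first exact: mem_cycle.
by rewrite -[w in LHS](mulgKV (u ^+ i)%g) /= coset_kerl.
Qed.

(** Extending the base field preserves coprimality, and coprime polynomials
have no common root. *)
Lemma root_dvdp p h alpha : irreducible_poly p ->
  root (map_poly iota p) alpha -> (root (map_poly iota h) alpha) = (p %| h).
Proof.
move=> irr pa0; apply/idP/idP=> [ha0 | /dvdpP[r ->]]; last first.
  by rewrite rmorphM /= rootM pa0 orbT.
apply: contraTT isT => ndvd.
have := irreducible_poly_coprime h irr; rewrite ndvd -(coprimep_map iota).
by move/coprimep_root => /(_ _ pa0); rewrite (rootP ha0) eqxx.
Qed.

Lemma horner_root_onto p alpha w : irreducible_poly p ->
  #|L| = (#|F| ^ (size p).-1)%N ->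
  root (map_poly iota p) alpha -> exists h, w = (map_poly iota h).[alpha].
Proof.
move=> irr cL pa0.
apply: (eval_onto (p := p) (m := (size p).-1)
  (ev := fun h => (map_poly iota h).[alpha])) => //.
- by move=> g h; rewrite rmorphB hornerD hornerN.
- by move=> g /rootP; rewrite (root_dvdp _ irr pa0).
- by rewrite prednK // (ltn_trans _ irr.1).
Qed.

End FieldGenerators.

(** Projective primitivity quantifies over all fields of the right size; it
yields something only because F[T]/(p) is one of them. *)
Lemma exists_root_field (F : finFieldType) (p : {poly F}) :
  irreducible_poly p -> p \is monic ->
  exists (L : finFieldType) (iota : {rmorphism F -> L}) (alpha : L),
    #|L| = (#|F| ^ (size p).-1)%N /\ root (map_poly iota p) alpha.
Proof.
move=> irr mon.
pose hI : monic_irreducible_poly p := (irr, mon).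
exists {poly %/ p with hI}, (qpolyC p : {rmorphism F -> {poly %/ p with hI}}).
exists ('qX : {poly %/ p}); split; first exact: card_qfpoly.
apply/rootP.
(* Substituting the class of T in p gives the class of p itself. *)
have := in_qpoly_comp_horner p p 'X; rewrite comp_polyXr => /esym e.
rewrite [LHS]e; apply: val_inj => /=.
by rewrite mk_monicE // Pdiv.RingMonic.rmodpp.
Qed.

(** * The equivalence *)

(** Both sides translate into congruences h = c T^i modulo chi, since chi | h
expresses the vanishing of h(A) u as well as that of h(alpha). *)
Lemma transitive_generatorP (F L : finFieldType) (iota : {rmorphism F -> L})
    (n : nat) (A : 'M[F]_n.+1) (alpha : L) :
  irreducible_poly (char_poly A) ->
  #|L| = (#|F| ^ n.+1)%N -> root (map_poly iota (char_poly A)) alpha ->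
  line_transitive A <-> scaled_powers_onto iota alpha.
Proof.
move=> irr cL ra.
have rd h := root_dvdp h irr ra.
have evZX c i : (map_poly iota (c *: 'X^i)).[alpha] = iota c * alpha ^+ i.
  by rewrite map_polyZ /= map_polyXn hornerZ hornerXn.
split=> [tr w w0 | onto u v u0 v0].
  have [|h wE] := horner_root_onto w irr _ ra.
    by rewrite size_char_poly.
  have [u u0] := exists_nonzero_cV F n.
  have hu0 : horner_vec A u h != 0.
    apply: contraNneq w0 => /(horner_vec_eq0 irr u0).
    by rewrite -rd wE => /rootP ->.
  have [c [i hE]] := tr u _ u0 hu0; exists c, i.
  apply/eqP; rewrite -evZX wE -subr_eq0 -hornerN -hornerD -rmorphB.
  have : char_poly A %| h - c *: 'X^i.
    by apply: (horner_vec_eq0 irr u0); rewrite horner_vecB horner_vecZX hE subrr.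
  by rewrite -rd.
have [h vE] := horner_vec_onto v irr u0.
have ha0 : (map_poly iota h).[alpha] != 0.
  apply: contraNneq v0 => /rootP; rewrite rd vE => dvd.
  by rewrite horner_vec_char.
have [c [i hE]] := onto _ ha0; exists c, i.
apply/eqP; rewrite -horner_vecZX vE -subr_eq0 -horner_vecB.
rewrite horner_vec_char // -rd rmorphB; apply/rootP.
by rewrite hornerD hornerN evZX hE subrr.
Qed.

Theorem theorem3p4 (F : finFieldType) (n : nat) (hn : (1 <= n)%N)
    (Psi : PGL F n) (M : {'GL_n.+1[F]}) (hM : Psi = PGL_class M) :
  transitive_map (PGL_act Psi) <-> projectively_primitive (char_poly (GLval M)).
Proof.
rewrite hM; apply: iff_trans (transitive_map_ext (PGL_act_class M)) _.
apply: iff_trans (GL_act_transitiveP M) _.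
split=> [tr | [irr gen]].
  have irr := line_transitive_irreducible hn tr.
  split=> // L iota; rewrite size_char_poly => cL alpha ra.
  (* A zero root would make chi divide T, whose degree is below n + 1. *)
  have a0 : alpha \is a GRing.unit.
    have ndvd : ~~ (char_poly (GLval M) %| 'X).
      apply/negP => /(dvdp_leq (monic_neq0 (monicX _))).
      by rewrite size_char_poly size_polyX !ltnS leqNgt hn.
    rewrite unitfE; apply: contraNneq ndvd => a0.
    by rewrite -(root_dvdp _ irr ra) map_polyX a0 rootX.
  exists (FinRing.Unit a0) => //; apply/coset_generatorP.
  exact/(transitive_generatorP irr cL ra).
have [L [iota [alpha [cL ra]]]] := exists_root_field irr (char_poly_monic _).
have [u uE /coset_generatorP] := gen L iota cL alpha ra.
rewrite uE; rewrite size_char_poly in cL.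
by case: (transitive_generatorP irr cL ra).
Qed.
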